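(* Let $k$ be a fixed positive integer. Given a graph $G$ on $n$ vertices, if $\alpha(G)\le k$ or $\omega(G)\le k$, then the problem MT-recognition can be solved on $G$ in time $\mathcal{O}(n^{2k+2})$.
   Context: All graphs are finite and simple. $\alpha(G)$ and $\omega(G)$ denote the independence number and the clique number of $G$. A graph $G$ is Maya-Tupi if its vertex set can be partitioned into two (possibly empty) sets $A$ and $B$ such that $\delta(G[A])\ge |A|-2$ (every vertex of $A$ is non-adjacent to at most one other vertex of $A$) and $\Delta(G[B])\le 1$. The decision problem MT-recognition is: given a graph $G$, is $G$ Maya-Tupi? *)

(* Defs.v *)
From mathcomp Require Import all_boot.
Set Implicit Arguments. Unset Strict Implicit. Unset Printing Implicit Defensive.

(** * Finite simple graphs *)

Record graph (T : finType) := Graph {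
  adj :> rel T;
  adj_sym : symmetric adj;
  adj_irrefl : irreflexive adj
}.

Section GraphParameters.
Variables (T : finType) (G : graph T).

Definition independent (S : {set T}) : bool :=
  [forall x in S, forall y in S, ~~ G x y].

Definition clique (S : {set T}) : bool :=
  [forall x in S, forall y in S, (x != y) ==> G x y].

Definition alpha : nat := \max_(S : {set T} | independent S) #|S|.

Definition omega : nat := \max_(S : {set T} | clique S) #|S|.

Definition degree (x : T) : nat := #|[set y | G x y]|.

Definition max_degree : nat := \max_(x : T) degree x.

(* All degrees are smaller than #|T|, so the default value #|T| of the iterated
   minimum only shows up for the graph without vertices, where it is 0. *)
Definition min_degree : nat := \big[minn/#|T|]_(x : T) degree x.

End GraphParameters.

Section Induced.
Variables (T : finType) (G : graph T) (A : {set T}).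

Definition induced_adj : rel {x : T | x \in A} := fun x y => G (val x) (val y).

Lemma induced_adj_sym : symmetric induced_adj.
Proof. by move=> x y; apply: adj_sym. Qed.

Lemma induced_adj_irrefl : irreflexive induced_adj.
Proof. by move=> x; apply: adj_irrefl. Qed.

Definition induced : graph {x : T | x \in A} :=
  Graph induced_adj_sym induced_adj_irrefl.

End Induced.

(* #|A| <= d + 2 stands for d >= #|A| - 2, where the difference is an integer. *)
Definition maya_tupi (T : finType) (G : graph T) : bool :=
  [exists A : {set T}, exists B : {set T},
    [&& A :|: B == [set: T], A :&: B == set0,
        #|A| <= min_degree (induced G A) + 2 &
        max_degree (induced G B) <= 1]].

(** * Word RAM

   A machine has registers and a random access memory, both indexed by nat and
   holding natural numbers below a word bound W.  A program is a structured
   (while) program over elementary instructions; each instruction and each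
   evaluation of a test costs one time unit.  Producing a value that is not
   below W is an error: the program then has no execution.  A program only
   mentions finitely many registers; unbounded storage is reached through
   Read and Write. *)

Record state := State { reg : nat -> nat; mem : nat -> nat }.

Definition upd (f : nat -> nat) (a v : nat) : nat -> nat :=
  fun b => if b == a then v else f b.

Inductive binop := Add | Sub | Mul.

(* Sub is truncated subtraction. *)
Definition eval_binop (o : binop) : nat -> nat -> nat :=
  match o with Add => addn | Sub => subn | Mul => muln end.

Inductive instr :=
  | Const of nat & nat               (* Const d v    :  r_d <- v         *)
  | Move of nat & nat                (* Move d a     :  r_d <- r_a       *)
  | Op of binop & nat & nat & nat    (* Op o d a b   :  r_d <- r_a o r_b *)
  | Read of nat & nat                (* Read d a     :  r_d <- mem[r_a]  *)
  | Write of nat & nat.              (* Write a b    :  mem[r_a] <- r_b  *)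

Definition set_reg (W d v : nat) (s : state) : option state :=
  if v < W then Some (State (upd (reg s) d v) (mem s)) else None.

Definition set_mem (W a v : nat) (s : state) : option state :=
  if (a < W) && (v < W) then Some (State (reg s) (upd (mem s) a v)) else None.

Definition exec_instr (W : nat) (i : instr) (s : state) : option state :=
  match i with
  | Const d v => set_reg W d v s
  | Move d a => set_reg W d (reg s a) s
  | Op o d a b => set_reg W d (eval_binop o (reg s a) (reg s b)) s
  | Read d a => set_reg W d (mem s (reg s a)) s
  | Write a b => set_mem W (reg s a) (reg s b) s
  end.

Inductive program :=
  | Skip
  | Instr of instr
  | Seq of program & program
  | If of nat & program & program    (* tests whether the register is nonzero *)
  | While of nat & program.          (* idem *)

(* exec W p s t s' : with word bound W, the program p started in s halts after
   exactly t time units in s'. *)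
Inductive exec (W : nat) : program -> state -> nat -> state -> Prop :=
  | exec_skip s : exec W Skip s 0 s
  | exec_instr_ok i s s' :
      exec_instr W i s = Some s' -> exec W (Instr i) s 1 s'
  | exec_seq p q s s' s'' t t' :
      exec W p s t s' -> exec W q s' t' s'' -> exec W (Seq p q) s (t + t') s''
  | exec_if_true r p q s s' t :
      reg s r != 0 -> exec W p s t s' -> exec W (If r p q) s t.+1 s'
  | exec_if_false r p q s s' t :
      reg s r = 0 -> exec W q s t s' -> exec W (If r p q) s t.+1 s'
  | exec_while_true r p s s' s'' t t' :
      reg s r != 0 -> exec W p s t s' -> exec W (While r p) s' t' s'' ->
      exec W (While r p) s (t + t').+1 s''
  | exec_while_false r p s :
      reg s r = 0 -> exec W (While r p) s 1 s.

(* Executions are unique, so the existence of an execution that ends with the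
   right answer means that the program halts and answers correctly. *)
Lemma exec_deterministic W p s t1 s1 t2 s2 :
  exec W p s t1 s1 -> exec W p s t2 s2 -> t1 = t2 /\ s1 = s2.
Proof.
move=> H; elim: H t2 s2 => {p s t1 s1}.
- by move=> s t2 s2 H; inversion H.
- by move=> i s s' E t2 s2 H; inversion H; split=> //; congruence.
- move=> p q s s' s'' t t' _ IHp _ IHq t2 s2 H; inversion H; subst.
  have [? ?] := IHp _ _ ltac:(eassumption); subst.
  by have [? ?] := IHq _ _ ltac:(eassumption); subst.
- move=> r p q s s' t nz _ IH t2 s2 H; inversion H; subst.
    by have [? ?] := IH _ _ ltac:(eassumption); subst.
  by move/eqP: nz.
- move=> r p q s s' t z _ IH t2 s2 H; inversion H; subst.
    by match goal with nz : is_true (_ != 0) |- _ => rewrite z in nz end.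
  by have [? ?] := IH _ _ ltac:(eassumption); subst.
- move=> r p s s' s'' t t' nz _ IHp _ IHw t2 s2 H; inversion H; subst.
    have [? ?] := IHp _ _ ltac:(eassumption); subst.
    by have [? ?] := IHw _ _ ltac:(eassumption); subst.
  by move/eqP: nz.
- move=> r p s z t2 s2 H; inversion H; subst=> //.
  by match goal with nz : is_true (_ != 0) |- _ => rewrite z in nz end.
Qed.

(** * Solving graph problems in time O(f(n)) *)

(* A graph on n vertices is presented by its adjacency matrix, stored row by
   row from address 0, with n in register 0; everything else is 0. *)
Definition input_state (n : nat) (G : graph 'I_n) : state :=
  State (fun r => if r == 0 then n else 0)
        (fun a => [exists i : 'I_n, exists j : 'I_n,
                     (a == i * n + j) && G i j] : nat).

(* One program p, independent of n and G, answers P (1 for yes, 0 for no, in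
   register 0) on all graphs satisfying the promise I, using words of O(log n)
   bits (values below (n + 2)^d) and worst-case time O(f(n)). *)
Definition solvable_in_time
    (I : forall n, graph 'I_n -> Prop) (P : forall n, graph 'I_n -> bool)
    (f : nat -> nat) : Prop :=
  exists (p : program) (d c n0 : nat), forall (n : nat) (G : graph 'I_n),
    I n G ->
    exists (t : nat) (s : state),
      [/\ exec (n.+2 ^ d) p (input_state G) t s,
          reg s 0 = P n G :> nat &
          n0 <= n -> t <= c * f n].

(* Main.v *)
Require Import Defs.
From mathcomp Require Import all_boot zify.
Set Implicit Arguments. Unset Strict Implicit.
Unset Printing Implicit Defensive.

(** In a set where each vertex has at most one conflict, keeping one vertex of
    each conflicting pair leaves at least half of the set.  So omega(G) <= k
    forces |A| <= 2k and alpha(G) <= k forces |B| <= 2k, and it suffices to try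
    as A and as B every set listed by a tuple of at most 2k vertices: O(n^(2k))
    candidates, each checked by comparing all pairs of vertices.  A partition
    found this way is a witness in any case, so the algorithm need not know
    which of the two bounds holds.

    The whole search is a closed arithmetic expression built from nested sums
    over the vertices; an expression with nesting depth D is evaluated on the
    word RAM in time O((n + 1)^D), with intermediate values polynomial in n. *)

(** * Selecting a conflict-free half of a set *)

Section HalfFree.
Variables (T : finType) (R : rel T).
Hypothesis R_sym : symmetric R.

(** Greedy selection: keep [x], discard the at most one vertex in conflict with it, and recurse on
    the rest. Each kept vertex accounts for at most two vertices of [S]. *)
Lemma half_free_subset (S : {set T}) :
  {in S, forall x, #|[set y in S | R x y]| <= 1} ->
  exists I : {set T}, [/\ I \subset S,
    {in I &, forall x y, x != y -> ~~ R x y} & #|S| <= 2 * #|I|].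
Proof.
have [m] := ubnP #|S|; elim: m S => // m IHm S ltSm degS.
have [->|[x Sx]] := set_0Vmem S.
  by exists set0; split; rewrite ?sub0set ?cards0 // => x y; rewrite inE.
pose N := x |: [set y in S | R x y].
have [|y Sy|I [subI freeI leI]] := IHm (S :\: N).
- rewrite -ltnS (leq_trans _ ltSm) // ltnS proper_card // properE subsetDl /=.
  by apply/subsetPn; exists x; rewrite // !inE eqxx.
- apply: leq_trans (degS y _); last by move: Sy; rewrite inE => /andP[].
  by apply/subset_leq_card/subsetP => z; rewrite !inE => /andP[/andP[_ ->]].
have xI : x \notin I.
  by apply/negP => /(subsetP subI); rewrite !inE eqxx.
have Rx y : y \in I -> ~~ R x y.
  move=> /(subsetP subI); rewrite !inE negb_or => /andP[/andP[_ nR] Sy].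
  by move: nR; rewrite Sy.
exists (x |: I); split.
- by rewrite subUset sub1set Sx (subset_trans subI) ?subsetDl.
- move=> y z; rewrite !inE => /orP[/eqP->|Iy] /orP[/eqP->|Iz]; rewrite ?eqxx //.
  + by move=> _; exact: Rx.
  + by move=> _; rewrite R_sym; exact: Rx.
  + exact: freeI.
- have := cardsID N S; rewrite cardsU1 xI.
  have : #|S :&: N| <= 2; last by lia.
  apply: leq_trans (subset_leq_card (subsetIr _ _)) _.
  by rewrite cardsU1; have := degS _ Sx; case: (_ \notin _); lia.
Qed.
End HalfFree.

(** * Maya-Tupi partitions in terms of conflicts *)

(** The first conjunct accounts for the default value [#|T|] of the iterated minimum. *)
Lemma leq_min_degree (T : finType) (H : graph T) m :
  (m <= min_degree H + 2) =
  (m <= #|T| + 2) && [forall x, m <= degree H x + 2].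
Proof.
apply/idP/andP => [le_m|[le_T /forallP le_m]].
  split; first apply: (leq_trans le_m).
    rewrite leq_add2r; apply: (@big_ind _ (fun z => z <= #|T|)) => //.
    + by move=> a b lea _; rewrite (leq_trans (geq_minl _ _)).
    + by move=> x _; apply: max_card.
  apply/forallP => x; apply: (leq_trans le_m); rewrite leq_add2r.
  rewrite /min_degree; elim: index_enum (mem_index_enum x) => //= y s IHs.
  rewrite inE big_cons geq_min => /orP[/eqP->|/IHs->]; last exact: orbT.
  by rewrite leqnn.
apply: (@big_ind _ (fun z => m <= z + 2)) => // a b.
by rewrite /minn; case: ifP.
Qed.

Section MayaTupi.
Variables (T : finType) (G : graph T).

(* A partition (A, ~: A) is as required when no vertex is in conflict with two
   others. *)
Definition conflict (A : {set T}) (x y : T) :=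
  [&& x != y, (x \in A) == (y \in A) & G x y == (x \notin A)].

Definition admissible (A : {set T}) :=
  [forall x, #|[set y | conflict A x y]| <= 1].

Lemma degree_induced (A : {set T}) x :
  degree (induced G A) x = #|[set y in A | G (val x) y]|.
Proof.
rewrite /degree -(card_imset _ val_inj); apply: eq_card => y.
apply/imsetP/idP => [[z]|].
  by rewrite !inE => Gxz ->; rewrite (valP z).
rewrite !inE => /andP[Ay Gxy]; exists (Sub y Ay); rewrite ?SubK //.
by rewrite inE.
Qed.

(** Inside [A] a conflict is a non-adjacency, so [A] splits into [x], its neighbours in [A] and its
    conflicts. *)
Lemma leq_card_min_degree (A : {set T}) :
  (#|A| <= min_degree (induced G A) + 2) =
  [forall x in A, #|[set y | conflict A x y]| <= 1].
Proof.
have key x (Ax : x \in A) :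
    #|A| = (#|[set y in A | G x y]| + #|[set y | conflict A x y]|).+1.
  rewrite (cardsD1 x) Ax add1n -(cardsID [set y | G x y] (A :\ x)).
  congr (_ + _).+1; apply: eq_card => y; rewrite !inE.
    by case: eqP => [->|] //=; rewrite adj_irrefl andbF.
  rewrite /conflict Ax /= eqbF_neg eq_sym; case: (x == y) => /=.
    by rewrite andbF.
  by rewrite andbC; case: (y \in A).
rewrite leq_min_degree card_sig leq_addr /=.
apply/forallP/forall_inP => [H x Ax|H x].
  have := H (Sub x Ax); rewrite degree_induced SubK (key x Ax); lia.
have Ax := valP x; have := H _ Ax; rewrite degree_induced.
by have := key _ Ax; lia.
Qed.

(** Outside [A] a conflict is an edge, so the conflicts of [x] are its neighbours in [~: A]. *)
Lemma max_degree_leq1 (A : {set T}) :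
  (max_degree (induced G (~: A)) <= 1) =
  [forall x in ~: A, #|[set y | conflict A x y]| <= 1].
Proof.
have key x (Ax : x \in ~: A) :
    [set y in ~: A | G x y] = [set y | conflict A x y].
  apply/setP => y; move: Ax; rewrite !inE /conflict => /negbTE->.
  rewrite eqb_id eq_sym [false == _]eq_sym eqbF_neg.
  by case: eqP => [->|] //=; rewrite ?adj_irrefl ?andbF.
apply/bigmax_leqP/forall_inP => [H x Ax|H x _].
  by have := H (Sub x Ax) isT; rewrite degree_induced SubK key.
by rewrite degree_induced key ?(valP x)// H ?(valP x).
Qed.

Lemma maya_tupi_admissible : maya_tupi G = [exists A, admissible A].
Proof.
apply/existsP/existsP => -[A].
  case/existsP => B /and4P[/eqP AB /eqP AB0].
  have -> : B = ~: A.
    apply/setP => x; have /setP/(_ x) := AB; have /setP/(_ x) := AB0.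
    by rewrite !inE; case: (x \in A); case: (x \in B).
  rewrite leq_card_min_degree max_degree_leq1 => /forall_inP HA /forall_inP HB.
  exists A; apply/forallP => x; case: (boolP (x \in A)) => [/HA//|nAx].
  by apply: HB; rewrite inE.
move=> /forallP H; exists A; apply/existsP; exists (~: A).
rewrite setUCr setICr !eqxx leq_card_min_degree max_degree_leq1 /=.
by apply/andP; split; apply/forall_inP => x _.
Qed.

Lemma admissible_card k (A : {set T}) :
  alpha G <= k \/ omega G <= k -> admissible A ->
  #|A| <= 2 * k \/ #|~: A| <= 2 * k.
Proof.
move=> small /forallP admA; case: small => small; [right|left].
  (* With adjacency as the relation, the selected half of [~: A] is independent. *)
  have [|x Bx|I [subI freeI leI]] := @half_free_subset _ (G : rel T) _ (~: A).
  - exact: adj_sym.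
  - apply: leq_trans (admA x); apply/subset_leq_card/subsetP => y.
    move: Bx; rewrite !inE /conflict => /negbTE-> /andP[/negbTE-> Gxy].
    by rewrite Gxy !eqxx !andbT; case: eqP Gxy => // ->; rewrite adj_irrefl.
  apply: (leq_trans leI); rewrite leq_mul2l /=; apply: leq_trans small.
  apply: (@leq_bigmax_cond _ _ (fun S : {set T} => #|S|)).
  apply/forall_inP => x Ix; apply/forall_inP => y Iy.
  by have [->|/freeI->//] := eqVneq x y; rewrite adj_irrefl.
(* With non-adjacency as the relation, the selected half of [A] is a clique. *)
have [||I [subI freeI leI]] :=
    @half_free_subset _ (fun x y => (x != y) && ~~ G x y) _ A.
- by move=> x y; rewrite eq_sym adj_sym.
- move=> x Ax; apply: leq_trans (admA x); apply/subset_leq_card/subsetP => y.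
  by rewrite !inE /conflict Ax => /andP[-> /andP[-> /negbTE->]].
apply: (leq_trans leI); rewrite leq_mul2l /=; apply: leq_trans small.
apply: (@leq_bigmax_cond _ _ (fun S : {set T} => #|S|)).
apply/forall_inP => x Ix; apply/forall_inP => y Iy; apply/implyP => nxy.
by have := freeI _ _ Ix Iy nxy; rewrite nxy negbK.
Qed.
End MayaTupi.

(* all_boot shadows the names mem and Sub of the machine model. *)
Import Defs.

(** * Time-bounded total correctness on the word RAM *)

Definition run (W : nat) (p : program) (s : state) (T : nat)
    (Q : state -> Prop) :=
  exists t s', [/\ exec W p s t s', t <= T & Q s'].

Lemma run_weaken W p s T T' (Q Q' : state -> Prop) :
  run W p s T Q -> T <= T' -> (forall s', Q s' -> Q' s') -> run W p s T' Q'.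
Proof.
move=> [t [s' [ex le_t Qs']]] le_T QQ'.
by exists t, s'; split; [|exact: leq_trans le_T|exact: QQ'].
Qed.

Lemma run_set_reg W i s d v (Q : state -> Prop) :
  exec_instr W i s = set_reg W d v s -> v < W ->
  Q (State (upd (reg s) d v) (mem s)) -> run W (Instr i) s 1 Q.
Proof.
move=> ei vW Qs; exists 1, (State (upd (reg s) d v) (mem s)); split=> //.
by apply: exec_instr_ok; rewrite ei /set_reg vW.
Qed.

(** Nesting the second run in the postcondition of the first lets a proof step through a program
    without naming intermediate assertions. *)
Lemma run_seq W p q s T1 T2 (Q : state -> Prop) :
  run W p s T1 (fun s1 => run W q s1 T2 Q) -> run W (Seq p q) s (T1 + T2) Q.
Proof.
move=> [t1 [s1 [ex1 le1 [t2 [s2 [ex2 le2 Qs2]]]]]].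
by exists (t1 + t2), s2; split; [exact: exec_seq ex1 ex2|exact: leq_add|].
Qed.

Lemma run_while_true W r p s T1 T2 (Q : state -> Prop) :
  reg s r != 0 -> run W p s T1 (fun s1 => run W (While r p) s1 T2 Q) ->
  run W (While r p) s (T1 + T2).+1 Q.
Proof.
move=> nz [t1 [s1 [ex1 le1 [t2 [s2 [ex2 le2 Qs2]]]]]].
exists (t1 + t2).+1, s2; split=> //; first exact: exec_while_true nz ex1 ex2.
by rewrite ltnS leq_add.
Qed.

(** * Arithmetic expressions and their compilation *)

(* Variables are de Bruijn indices; a variable that is out of scope denotes n.
   Sum binds a variable that ranges over 0, ..., n - 1. *)
Inductive expr :=
  | Var of nat
  | Cst of nat
  | Bin of binop & expr & expr
  | Peek of expr
  | Sum of expr.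

Fixpoint eval (n : nat) (M : nat -> nat) (env : seq nat) (e : expr) : nat :=
  match e with
  | Var i => nth n env i
  | Cst v => v
  | Bin o e1 e2 => eval_binop o (eval n M env e1) (eval n M env e2)
  | Peek e => M (eval n M env e)
  | Sum e => \sum_(0 <= v < n) eval n M (v :: env) e
  end.

(* The variables live in the registers rs, all below d, and register 0 holds n;
   the value is left in register d and no register below d is modified. *)
Fixpoint compile (rs : seq nat) (d : nat) (e : expr) : program :=
  match e with
  | Var i => Instr (Move d (nth 0 rs i))
  | Cst v => Instr (Const d v)
  | Bin o e1 e2 =>
      Seq (compile rs d e1) (Seq (compile rs d.+1 e2) (Instr (Op o d d d.+1)))
  | Peek e => Seq (compile rs d e) (Instr (Read d d))
  | Sum e =>
      Seq (Instr (Const d 0)) (Seq (Instr (Move d.+1 0))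
        (While d.+1
          (Seq (Instr (Const d.+2 1)) (Seq (Instr (Op Sub d.+1 d.+1 d.+2))
            (Seq (compile (d.+1 :: rs) d.+2 e) (Instr (Op Add d d d.+2)))))))
  end.

(** Exponent of [n.+2] in a strict bound on the value; a constant [v] is below [2 ^ v.+1], and
    already below [2 ^ v]. *)
Fixpoint width (e : expr) : nat :=
  match e with
  | Var _ => 1
  | Cst v => v
  | Bin _ e1 e2 => (width e1 + width e2).+1
  | Peek e => (width e).+1
  | Sum e => (width e).+1
  end.

Fixpoint depth (e : expr) : nat :=
  match e with
  | Var _ | Cst _ => 0
  | Bin _ e1 e2 => maxn (depth e1) (depth e2)
  | Peek e => depth e
  | Sum e => (depth e).+1
  end.

(** Factor of [n.+1 ^ depth e] in the time bound. For [Sum], 7 covers four extra steps per iteration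
    (test, two counter instructions, addition), two initialisations and the final test. *)
Fixpoint cost (e : expr) : nat :=
  match e with
  | Var _ | Cst _ => 1
  | Bin _ e1 e2 => (cost e1 + cost e2).+1
  | Peek e => (cost e).+1
  | Sum e => cost e + 7
  end.

Section Compilation.
Variables (n : nat) (M : nat -> nat).
Hypothesis M_bool : forall a, M a <= 1.

(** Bounds of operands multiply; one further factor [n.+2] absorbs an addition or the [n] terms of a
    sum. *)
Lemma eval_bound e env :
  all (leq^~ n) env -> eval n M env e < n.+2 ^ width e.
Proof.
elim: e env => [i|v|o e1 IH1 e2 IH2|e IH|e IH] env env_n /=.
- rewrite expn1; have [lt_i|ge_i] := ltnP i (size env).
    by have := all_nthP n env_n i lt_i; lia.
  by rewrite nth_default; lia.
- apply: leq_trans (ltn_expl v (ltnSn 1)) _.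
  by case: v => // v; rewrite leq_exp2r.
- have := IH1 _ env_n; have := IH2 _ env_n; rewrite expnS expnD.
  set a := eval _ _ _ e1; set b := eval _ _ _ e2.
  set A := _ ^ width e1; set B := _ ^ width e2 => ltb lta.
  by case: o => /=; nia.
- have := M_bool (eval n M env e); rewrite expnS.
  by have : 0 < n.+2 ^ width e; [rewrite expn_gt0|nia].
- rewrite expnS; set A := _ ^ _.
  have A_gt0 : 0 < A by rewrite expn_gt0.
  have : \sum_(0 <= v < n) eval n M (v :: env) e <= \sum_(0 <= v < n) A.
    rewrite !big_mkord; apply: leq_sum => v _; apply/ltnW/IH => /=.
    by rewrite env_n andbT ltnW.
  by rewrite sum_nat_const_nat subn0; nia.
Qed.

Definition computed (s : state) (d v : nat) (s' : state) :=
  [/\ reg s' d = v, forall r, r < d -> reg s' r = reg s r & mem s' = mem s].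

(** The two defaults in the hypothesis on [rs] agree: an index out of scope selects register 0,
    which holds [n]. Leaving [W] free lets subexpressions share one word bound. *)
Lemma compile_correct W e rs d s env :
  0 < d -> all (ltn^~ d) rs -> all (leq^~ n) env -> reg s 0 = n ->
  (forall i, reg s (nth 0 rs i) = nth n env i) -> mem s = M ->
  n.+2 ^ width e <= W ->
  run W (compile rs d e) s (cost e * n.+1 ^ depth e)
    (computed s d (eval n M env e)).
Proof.
elim: e rs d s env => [i|v|o e1 IH1 e2 IH2|e IH|e IH] rs d s env
    d_gt0 rs_d env_n s0 rsE sM leW /=.
- apply: (@run_set_reg _ _ _ d (nth n env i)) => //=.
  + by rewrite rsE.
  + exact: leq_trans (eval_bound (Var i) env_n) leW.
  + by split=> //= [|r lt_r]; rewrite /upd ?eqxx ?ltn_eqF.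
- apply: (@run_set_reg _ _ _ d v) => //=.
  + exact: leq_trans (eval_bound (Cst v) env_n) leW.
  + by split=> //= [|r lt_r]; rewrite /upd ?eqxx ?ltn_eqF.
- have [le1 le2] : n.+2 ^ width e1 <= W /\ n.+2 ^ width e2 <= W.
    by split; apply: leq_trans leW; rewrite leq_exp2l //=; lia.
  apply: (@run_weaken _ _ _ (cost e1 * n.+1 ^ depth e1 +
            (cost e2 * n.+1 ^ depth e2 + 1)) _
            (computed s d (eval n M env (Bin o e1 e2)))) => //; last first.
    have : n.+1 ^ depth e1 <= n.+1 ^ maxn (depth e1) (depth e2).
      by rewrite leq_pexp2l ?leq_maxl.
    have : n.+1 ^ depth e2 <= n.+1 ^ maxn (depth e1) (depth e2).
      by rewrite leq_pexp2l ?leq_maxr.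
    have : 0 < n.+1 ^ maxn (depth e1) (depth e2) by rewrite expn_gt0.
    by nia.
  apply: run_seq; apply: run_weaken (IH1 _ _ _ _ _ _ env_n _ _ _ _) _ _ => //.
  move=> s1 [s1d s1r s1M].
  apply: run_seq.
  apply: run_weaken (IH2 _ _ _ _ _ _ env_n _ _ _ _) _ _ => //.
  + by apply: sub_all rs_d => r /=; apply: ltnW.
  + by rewrite s1r.
  + move=> i; rewrite s1r //; have [lt_i|ge_i] := ltnP i (size rs).
      exact: (all_nthP 0 rs_d).
    by rewrite nth_default.
  + by rewrite s1M.
  move=> s2 [s2d s2r s2M].
  apply: (@run_set_reg _ _ _ d (eval n M env (Bin o e1 e2))) => //=.
  + by rewrite s2d s2r ?s1d.
  + exact: leq_trans (eval_bound (Bin o e1 e2) env_n) leW.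
  + split=> //= [|r lt_r|]; rewrite /upd ?eqxx ?ltn_eqF //.
      by rewrite s2r ?s1r // ltnW.
    by rewrite s2M.
- have le1 : n.+2 ^ width e <= W.
    by apply: leq_trans leW; rewrite leq_exp2l //=.
  apply: (@run_weaken _ _ _ (cost e * n.+1 ^ depth e + 1) _
            (computed s d (eval n M env (Peek e)))) => //; last first.
    by have : 0 < n.+1 ^ depth e; [rewrite expn_gt0|nia].
  apply: run_seq; apply: run_weaken (IH _ _ _ _ _ _ env_n _ _ _ _) _ _ => //.
  move=> s1 [s1d s1r s1M].
  apply: (@run_set_reg _ _ _ d (eval n M env (Peek e))) => //=.
  + by rewrite s1d s1M sM.
  + exact: leq_trans (eval_bound (Peek e) env_n) leW.
  + by split=> //= [|r lt_r]; rewrite /upd ?eqxx ?ltn_eqF ?s1r.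
- have le1 : n.+2 ^ width e <= W.
    by apply: leq_trans leW; rewrite leq_exp2l //=.
  have W_gt : n.+1 < W.
    by apply: leq_trans leW; rewrite /= expnS leq_pmulr // expn_gt0.
  pose T := cost e * n.+1 ^ depth e; set body := Seq (Instr (Const d.+2 _)) _.
  pose f v := eval n M (v :: env) e.
  (* Invariant: register [d] accumulates and [d.+1] counts down, so the terms below [m] are still to
     be added. Bounding the final total by [W] makes every partial sum fit in a word. *)
  have loop m s1 : m <= n -> reg s1 d.+1 = m ->
      (forall r, r < d -> reg s1 r = reg s r) -> mem s1 = mem s ->
      reg s1 d + \sum_(0 <= v < m) f v < W ->
      run W (While d.+1 body) s1 (m * (T + 4) + 1)
        (computed s d (reg s1 d + \sum_(0 <= v < m) f v)).
    elim: m s1 => [|m IHm] s1 le_m s1m s1r s1M ltW.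
      exists 1, s1; split=> //; first exact: exec_while_false.
      by split=> //; rewrite big_nil addn0.
    rewrite big_nat_recr //= in ltW *.
    rewrite (_ : _ + 1 = (T + 3 + (m * (T + 4) + 1)).+1); last by lia.
    apply: run_while_true; first by rewrite s1m.
    rewrite (_ : T + 3 = 1 + (1 + (T + 1))); last by lia.
    apply: run_seq; apply: (@run_set_reg _ _ _ d.+2 1) => //; first by lia.
    apply: run_seq; apply: (@run_set_reg _ _ _ d.+1 m) => //=.
    + by rewrite /upd eqxx ltn_eqF // s1m subn1.
    + by lia.
    set s2 := State _ _.
    have s2r r : r <= d -> reg s2 r = reg s1 r.
      by move=> le_r; rewrite /s2 /= /upd !ltn_eqF // ltnS // ltnW.
    have s2rd r : r < d -> reg s2 r = reg s r.
      by move=> lt_r; rewrite s2r ?s1r // ltnW.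
    have s2m : reg s2 d.+1 = m by rewrite /s2 /= /upd eqxx.
    have rs_lt i : nth 0 rs i < d.
      have [lt_i|ge_i] := ltnP i (size rs); first exact: (all_nthP 0 rs_d).
      by rewrite nth_default.
    apply: run_seq.
    apply: run_weaken (IH _ _ _ (m :: env) _ _ _ _ _ _ _) _ _ => //.
    + rewrite /= ltnSn /=; apply: sub_all rs_d => r /= lt_r.
      by rewrite ltnS ltnW // ltnS ltnW.
    + by rewrite /= env_n andbT ltnW.
    + by rewrite s2rd.
    + by case=> [|i]; [exact: s2m|exact: etrans (s2rd _ (rs_lt i)) (rsE i)].
    + by rewrite /= s1M.
    move=> s3 [s3d s3r s3M].
    apply: (@run_set_reg _ _ _ d (reg s1 d + f m)) => //=.
    + by rewrite s3d s3r // s2r.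
    + by move: ltW; lia.
    set s4 := State _ _.
    have s4d : reg s4 d = reg s1 d + f m by rewrite /s4 /= /upd eqxx.
    rewrite [_ + f m]addnC addnA -s4d.
    apply: IHm => //.
    + exact: ltnW.
    + by rewrite /s4 /= /upd gtn_eqF // s3r.
    + move=> r lt_r; rewrite /s4 /= /upd ltn_eqF // s3r ?s2rd //.
      by rewrite ltnS ltnW // ltnS ltnW.
    + by rewrite /= s3M.
    + by rewrite s4d; move: ltW; lia.
  apply: (@run_weaken _ _ _ (1 + (1 + (n * (T + 4) + 1))) _
            (computed s d (eval n M env (Sum e)))) => //; last first.
    have : 0 < n.+1 ^ depth e by rewrite expn_gt0.
    by rewrite /T expnS; nia.
  apply: run_seq; apply: (@run_set_reg _ _ _ d 0) => //; first by lia.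
  apply: run_seq; apply: (@run_set_reg _ _ _ d.+1 n) => //=; try by lia.
    by rewrite /upd ltn_eqF // s0.
  set s1 := State _ _.
  have s1d : reg s1 d = 0 by rewrite /s1 /= /upd eqxx ltn_eqF.
  have := loop n s1; rewrite s1d; apply=> //.
  + by rewrite /s1 /= /upd eqxx.
  + by move=> r lt_r; rewrite /s1 /= /upd !ltn_eqF // ltnS ltnW.
  + exact: leq_trans (eval_bound (Sum e) env_n) leW.
Qed.
End Compilation.

(** * Logic by arithmetic *)

(* Truth values are 0 and 1, and Sub is truncated. *)
Definition neg (e : expr) := Bin Sub (Cst 1) e.

(** The two truncated differences are both zero exactly when the values agree. *)
Definition equ (e1 e2 : expr) := neg (Bin Add (Bin Sub e1 e2) (Bin Sub e2 e1)).

Definition total (es : seq expr) := foldr (Bin Add) (Cst 0) es.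

Section Formulas.
Variables (n : nat) (M : nat -> nat).

Lemma eval_bin o env e1 e2 :
  eval n M env (Bin o e1 e2) =
  eval_binop o (eval n M env e1) (eval n M env e2).
Proof. by []. Qed.

Lemma eval_Sum env e :
  eval n M env (Sum e) = \sum_(v < n) eval n M (val v :: env) e.
Proof. exact: big_mkord. Qed.

Lemma eval_neg env e : eval n M env (neg e) = (eval n M env e == 0).
Proof. by rewrite /neg /=; case: eval. Qed.

Lemma eval_equ env e1 e2 :
  eval n M env (equ e1 e2) = (eval n M env e1 == eval n M env e2).
Proof. by rewrite eval_neg /=; lia. Qed.

Lemma eval_total env es :
  eval n M env (total es) = \sum_(e <- es) eval n M env e.
Proof. by elim: es => [|e es IH] /=; rewrite ?big_nil // big_cons IH. Qed.

(** A sum of naturals is positive when some term is, so nested sums act as an existential quantifier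
    over tuples. *)
Lemma eval_iter_Sum m env e :
  0 < eval n M env (iter m Sum e) <->
  exists vs, [/\ size vs = m, all (ltn^~ n) vs & 0 < eval n M (vs ++ env) e].
Proof.
elim: m e => [|m IHm] e.
  by split=> [e_gt0|[vs [/size0nil->]]//]; exists [::].
rewrite iterSr IHm; split=> [[vs [vs_m vs_n]]|[[|v vs] [//= [vs_m]]]].
  rewrite /= lt0n sum_nat_seq_neq0 => /hasP[v].
  rewrite mem_index_iota /= => v_n e_neq0.
  by exists (v :: vs); rewrite /= vs_m v_n lt0n; split.
move=> /andP[v_n vs_n] e_gt0; exists vs; split=> //=.
rewrite lt0n sum_nat_seq_neq0; apply/hasP.
by exists v; rewrite ?mem_index_iota //= -lt0n.
Qed.
End Formulas.

Lemma depth_neg e : depth (neg e) = depth e.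
Proof. exact: max0n. Qed.

Lemma depth_equ e1 e2 : depth (equ e1 e2) = maxn (depth e1) (depth e2).
Proof. by rewrite depth_neg /= [X in maxn _ X]maxnC maxnn. Qed.

Lemma depth_iter_Sum m e : depth (iter m Sum e) = m + depth e.
Proof. by elim: m => //= m ->. Qed.

Lemma depth_total (I : eqType) (s : seq I) (F : I -> expr) D :
  {in s, forall i, depth (F i) <= D} -> depth (total [seq F i | i <- s]) <= D.
Proof.
elim: s => //= i s IHs leD; rewrite geq_max leD ?mem_head // IHs // => j sj.
by rewrite leD // inE sj orbT.
Qed.

(** * The recognition algorithm as an expression *)

(* The set S is listed by the m variables 2, ..., m + 1, while the variables
   1 and 0 hold the two vertices to be compared; variable m + 2 is n. *)
Definition outside (m x : nat) : expr :=
  neg (total [seq equ (Var x) (Var l) | l <- iota 2 m]).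

Definition adjacent (m : nat) : expr :=
  Peek (Bin Add (Bin Mul (Var 1) (Var m.+2)) (Var 0)).

Definition signed (b : bool) (e : expr) := if b then e else neg e.

(* The listed set S is A if inA holds, and B otherwise. *)
Definition clash (inA : bool) (m : nat) : expr :=
  Bin Mul (neg (equ (Var 1) (Var 0)))
    (Bin Mul (equ (outside m 1) (outside m 0))
      (signed inA (equ (adjacent m) (outside m 1)))).

(** Truncation makes the inner difference the excess of the number of clashes over 1; no vertex may
    have any. *)
Definition valid (inA : bool) (m : nat) : expr :=
  neg (Sum (Bin Sub (Sum (clash inA m)) (Cst 1))).

(** The double negation turns the number of successes into 0 or 1. *)
Definition recognizer (k : nat) : expr :=
  neg (neg (total
    [seq iter m Sum (Bin Add (valid true m) (valid false m))
      | m <- iota 0 (2 * k).+1])).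

Lemma depth_outside m x : depth (outside m x) = 0.
Proof. by apply/eqP; rewrite depth_neg -leqn0 depth_total. Qed.

Lemma depth_valid inA m : depth (valid inA m) = 2.
Proof.
have /= := depth_outside m 1; have /= := depth_outside m 0; rewrite !max0n.
by case: inA => d0 d1; rewrite /= !max0n !d0 !d1.
Qed.

(** At most [2 * k] sums list the set and two compare vertices; membership tests are unrolled and
    contain no [Sum]. *)
Lemma depth_recognizer k : depth (recognizer k) <= 2 * k + 2.
Proof.
rewrite !depth_neg; apply: depth_total => m.
rewrite mem_iota /= add0n ltnS => le_m.
rewrite depth_iter_Sum leq_add //.
rewrite -[depth _]/(maxn (depth (valid true m)) (depth (valid false m))).
by rewrite !depth_valid.
Qed.

(** * Correctness of the recognition algorithm *)

Section Correctness.
Variables (n : nat) (G : graph 'I_n).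
Let M := mem (input_state G).

(** Quotient and remainder by [n] recover the row and the column from the address. *)
Lemma input_memory (i j : 'I_n) : M (i * n + j) = G i j.
Proof.
rewrite /M /=; congr nat_of_bool; apply/existsP/idP => [[i' /existsP[j']]|Gij].
  case/andP=> /eqP eq_a.
  have n_gt0 : 0 < n by apply: leq_trans (ltn_ord i).
  have -> : i' = i.
    apply: val_inj; have := congr1 (divn^~ n) eq_a.
    by rewrite /= !divnMDl // !divn_small // !addn0.
  suff -> : j' = j by [].
  apply: val_inj; have := congr1 (modn^~ n) eq_a.
  by rewrite /= !modnMDl !modn_small.
by exists i; apply/existsP; exists j; rewrite eqxx.
Qed.

Lemma eval_outside (env vs : seq nat) x :
  size env = 2 ->
  eval n M (env ++ vs) (outside (size vs) x) =
  (nth n (env ++ vs) x \notin vs).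
Proof.
move=> env2; rewrite eval_neg eval_total big_map; congr nat_of_bool.
under eq_bigr do rewrite eval_equ.
have vsE : [seq nth n (env ++ vs) l | l <- iota 2 (size vs)] = vs.
  rewrite map_nth_iota; last by rewrite size_cat env2 addKn.
  by rewrite drop_cat env2 /= drop0 take_size.
rewrite -[X in _ \notin X]vsE sum_nat_seq_eq0 -has_pred1 has_map -all_predC.
by apply: eq_all => l /=; rewrite eqb0 eq_sym.
Qed.

(** Complementing the set preserves the same-side test and negates the adjacency condition, hence
    [signed]. *)
Lemma eval_clash inA (vs : seq nat) (i j : 'I_n) :
  let S := [set x : 'I_n | val x \in vs] in
  eval n M [:: val j, val i & vs] (clash inA (size vs)) =
  conflict G (if inA then S else ~: S) i j.
Proof.
set env := [:: _, _ & _] => S.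
have out1 : eval n M env (outside (size vs) 1) = (i \notin S).
  by rewrite (@eval_outside [:: val j; val i]) // inE.
have out0 : eval n M env (outside (size vs) 0) = (j \notin S).
  by rewrite (@eval_outside [:: val j; val i]) // inE.
have adj : eval n M env (adjacent (size vs)) = G i j.
  by rewrite /= nth_default // input_memory.
have sgn : eval n M env (signed inA (equ (adjacent (size vs))
    (outside (size vs) 1))) = ((G i j == (i \notin S)) == inA).
  have := eval_equ n M env (adjacent (size vs)) (outside (size vs) 1).
  rewrite adj out1 /signed; case: inA => e; [rewrite e|rewrite eval_neg e];
    by case: (G i j); case: (i \notin S).
rewrite !(eval_bin _ _ Mul) eval_neg sgn !eval_equ out1 out0 /=.
rewrite !mulnb eqb0 /conflict; congr nat_of_bool; congr (_ && _).
by case: inA {sgn}; rewrite !inE; case: (_ \in vs); case: (_ \in vs);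
  case: (G i j).
Qed.

Lemma eval_valid inA (vs : seq nat) :
  let S := [set x : 'I_n | val x \in vs] in
  eval n M vs (valid inA (size vs)) = admissible G (if inA then S else ~: S).
Proof.
move=> S; rewrite eval_neg eval_Sum sum_nat_eq0; congr nat_of_bool.
apply: eq_forallb => i; rewrite eval_bin eval_Sum subn_eq0; congr (_ <= 1).
under eq_bigr do rewrite eval_clash.
by rewrite cardsE -sum1_card [RHS]big_mkcond.
Qed.

Lemma eval_recognizer k :
  alpha G <= k \/ omega G <= k -> eval n M [::] (recognizer k) = maya_tupi G.
Proof.
move=> small; rewrite !eval_neg eqb0 -lt0n eval_total big_map.
rewrite maya_tupi_admissible lt0n sum_nat_seq_neq0; congr nat_of_bool.
apply/hasP/existsP => [[m _]|[A admA]].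
  rewrite -lt0n => /eval_iter_Sum[vs [<- _]].
  by rewrite cats0 eval_bin !eval_valid addn_gt0 !lt0b => /orP[] adm; eexists;
    exact: adm.
have [S [S_2k admS]] : exists S : {set 'I_n},
    #|S| <= 2 * k /\ (admissible G S || admissible G (~: S)).
  have [A_2k|A_2k] := admissible_card small admA; [exists A|exists (~: A)].
    by rewrite admA.
  by rewrite setCK admA orbT.
(* The successful tuple is the enumeration of the small side [S]. *)
exists #|S|; first by rewrite mem_iota.
rewrite andTb -lt0n; apply/eval_iter_Sum; exists (map val (enum S)).
have vsS : [set x : 'I_n | val x \in map val (enum S)] = S.
  by apply/setP => x; rewrite inE (mem_map val_inj) mem_enum.
have size_vs : size (map val (enum S)) = #|S| by rewrite size_map -cardE.
split=> //; first by apply/allP => _ /mapP[x _ ->]; exact: ltn_ord.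
rewrite cats0 -size_vs.
by rewrite eval_bin !eval_valid vsS addn_gt0 !lt0b.
Qed.
End Correctness.

Theorem proposition3p3 (k : nat) (hk : 0 < k) :
  solvable_in_time
    (fun (n : nat) (G : graph 'I_n) => alpha G <= k \/ omega G <= k)
    (fun (n : nat) (G : graph 'I_n) => maya_tupi G)
    (fun n : nat => n ^ (2 * k + 2)).
Proof.
pose e := recognizer k; pose D := 2 * k + 2.
exists (Seq (compile [::] 1 e) (Instr (Move 0 1))), (width e).
(* The successor pays for the final [Move]; the factor [2 ^ D] comes from [n.+1 <= 2 * n], which
   requires [n >= 1]. *)
exists ((cost e).+1 * 2 ^ D), 1 => n G small.
have M_bool a : mem (input_state G) a <= 1 by exact: leq_b1.
have := @compile_correct n _ M_bool (n.+2 ^ width e) e [::] 1 (input_state G)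
  [::] isT isT isT erefl _ erefl (leqnn _).
case=> [i|t [s [ex_s le_t [s1 _ _]]]]; first by rewrite !nth_nil.
have [u [s' [ex_s' le_u s'0]]] : run (n.+2 ^ width e) (Instr (Move 0 1)) s 1
    (fun s' => reg s' 0 = maya_tupi G).
  rewrite eval_recognizer // in s1.
  apply: (@run_set_reg _ _ _ 0 (maya_tupi G)); rewrite /= ?s1 //.
  by rewrite -(eval_recognizer small); exact: eval_bound.
exists (t + u), s'; split=> // [|n_gt0]; first exact: exec_seq ex_s ex_s'.
have {}le_t : t <= cost e * n.+1 ^ D.
  by rewrite (leq_trans le_t) // leq_mul2l leq_pexp2l ?depth_recognizer ?orbT.
have : n.+1 ^ D <= 2 ^ D * n ^ D.
  by rewrite -expnMn leq_exp2r ?addn2 //; lia.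
have : 0 < n.+1 ^ D by rewrite expn_gt0.
by rewrite -/D; nia.
Qed.
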